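(* Let $n\ge 2$, let $p=(p_1,\dots,p_n)\in\mathcal{L}_n$ be a Lehmer code and write its descent set as $D(p)=\{d_1<d_2<\cdots<d_m\}$. Then $p\in\operatorname{Max}\mathcal{L}_n(3\underline{21})$ if and only if the following conditions hold: (a) $p$ has a first descent and $d_1\in\{1,2\}$; (b) $p_{d_j}+d_j=n-(m-j)$ for $1\le j\le m$; (c) $p$ is constant on each of the intervals (of integers) $[1,d_1],\ [d_1+1,d_2],\ [d_2+1,d_3],\ \ldots,\ [d_{m-1}+1,d_m],\ [d_m+1,n]$.
   Context: $\mathcal{S}_n$ is the set of permutations $\pi=\pi_1\cdots\pi_n$ of $\{1,\dots,n\}$. The set of Lehmer codes is $\mathcal{L}_n=\{(p_1,\dots,p_n)\in\mathbb{Z}^n:0\le p_i\le n-i\}$. The Lehmer code of $\pi\in\mathcal{S}_n$ is $L(\pi)=(p_1,\dots,p_n)$ with $p_i=|\{j>i:\pi_j<\pi_i\}|$; $L:\mathcal{S}_n\to\mathcal{L}_n$ is a bijection. The descent set of $p\in\mathcal{L}_n$ is $D(p)=\{j\in\{1,\dots,n-1\}:p_j>p_{j+1}\}$. A permutation $\pi$ avoids the vincular pattern $3\underline{21}$ if there are no indices $i<j\le n-1$ with $\pi_i>\pi_j>\pi_{j+1}$. $\mathcal{L}_n(3\underline{21})$ is the set of Lehmer codes of all $3\underline{21}$-avoiding permutations in $\mathcal{S}_n$, partially ordered by $s\preceq t$ iff $s_i\le t_i$ for all $i$; $\operatorname{Max}\mathcal{L}_n(3\underline{21})$ is its set of maximal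 elements. *)

(* Defs.v *)
From mathcomp Require Import all_boot all_fingroup.
Set Implicit Arguments.
Unset Strict Implicit.
Unset Printing Implicit Defensive.

(* s_i with 1-based indexing, used only for 1 <= i <= size s. *)
Definition ent (s : seq nat) (i : nat) : nat := nth 0 s i.-1.

(* The element i : 'I_n stands for the integer i.+1 of {1, ..., n}, both as a
   position and as a value of a permutation. *)
Definition lehmer (n : nat) (pi : 'S_n) : n.-tuple nat :=
  [tuple #|[set j : 'I_n | (i < j) && (pi j < pi i)]| | i < n].

Definition is_lehmer_code (n : nat) (p : n.-tuple nat) : Prop :=
  forall i, 1 <= i <= n -> ent p i <= n - i.

Definition descent (n : nat) (p : n.-tuple nat) : pred nat :=
  fun j => (1 <= j <= n - 1) && (ent p j > ent p j.+1).

Definition avoids_3_21 (n : nat) (pi : 'S_n) : Prop :=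
  ~ exists i j k : 'I_n,
      [/\ i < j, k = j.+1 :> nat, pi i > pi j & pi j > pi k].

Definition codes_3_21 (n : nat) (p : n.-tuple nat) : Prop :=
  exists2 pi : 'S_n, avoids_3_21 pi & p = lehmer pi.

Definition code_le (n : nat) (s t : n.-tuple nat) : Prop :=
  forall i, 1 <= i <= n -> ent s i <= ent t i.

Definition Max_codes_3_21 (n : nat) (p : n.-tuple nat) : Prop :=
  codes_3_21 p /\
  forall q : n.-tuple nat, codes_3_21 q -> code_le p q -> q = p.

Definition constant_on (s : seq nat) (a b : nat) : Prop :=
  forall i k, a <= i <= b -> a <= k <= b -> ent s i = ent s k.

(* b_0 = 0, b_j = d_j for 1 <= j <= m, b_(m+1) = n, so that the intervals
   [1, d_1], [d_1 + 1, d_2], ..., [d_m + 1, n] are the [b_j + 1, b_(j+1)]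
   for 0 <= j <= m. *)
Definition breakpoint (n : nat) (d : seq nat) (j : nat) : nat :=
  nth 0 (0 :: rcons d n) j.

(* Main.v *)
Require Import Defs.
From mathcomp Require Import all_boot all_fingroup.
From mathcomp Require Import zify.

Set Implicit Arguments.
Unset Strict Implicit.
Unset Printing Implicit Defensive.

(** In terms of a code [f], the value [pi i] at a left-to-right maximum is
    [f i + i], and the maximum of the first [j] values of [pi] is the largest
    [f i + i] with [i <= j].  Avoiding the pattern says that every descent top
    is a left-to-right maximum, and descents of [pi] are descents of [f].  So
    the codes of avoiding permutations are the [f] with [f i + i <= n] in which
    every descent [j] satisfies [f i + i < f j + j] for all [i < j]
    ([codes_3_21P]); the rest of the argument is about such functions.

    Let [d_1 < ... < d_m] be the descents of such a code.  The numbers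
    [f d_j + d_j] increase strictly and are at most [n], so
    [f d_j + d_j <= n - (m - j)].  Moreover [f] does not decrease inside the
    intervals cut out by the descents.  Hence [f] is at most the function
    [fill] that is constant on each interval and turns all these bounds into
    equalities ([good_le_fill]).  Since [fill] is again the code of an avoiding
    permutation ([good_fill]), a maximal code equals it, which is (b) and (c)
    ([fillP]).  For (a): if neither 1 nor 2 is a descent, the first entry can be
    raised by one ([good_raise_first]).

    Conversely, suppose that [d_1 <= 2] and that a code [q] of an avoiding
    permutation lies above [fill].  Going from the right end to the left, [q]
    agrees with [fill] beyond a position [i].  An excess at [i] would make [i] a
    descent of [q], so [q i + i] would lie strictly between the consecutive
    levels [n - (m - j) - 1] and [n - (m - j)] of two descents, or beyond [n].
    Only in the first interval is there no level below, and [d_1 <= 2] replaces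
    it ([fill_maximal]). *)

(** * Codes of avoiding permutations *)

Definition inv_count (n : nat) (pi : 'S_n) (i : 'I_n) : nat :=
  #|[set j : 'I_n | (i < j) && (pi j < pi i)]|.

(** When [pi i] is a left-to-right maximum, this set is the preimage of the
    values up to [pi i]. *)
Definition left_or_below (n : nat) (pi : 'S_n) (i : 'I_n) : {set 'I_n} :=
  [set l : 'I_n | (l <= i) || (pi l <= pi i)].

Lemma ent_lehmer (n : nat) (pi : 'S_n) (i : 'I_n) :
  ent (lehmer pi) i.+1 = inv_count pi i.
Proof. by rewrite /ent -(tnth_nth 0 (lehmer pi)) tnth_mktuple. Qed.

Lemma card_ord_lt (n v : nat) : v <= n -> #|[set w : 'I_n | w < v]| = v.
Proof.
move=> le_vn; rewrite -sum1_card.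
under eq_bigl => w do rewrite inE.
by rewrite -(big_ord_widen n (fun=> 1) le_vn) sum1_card card_ord.
Qed.

Lemma perm_ltn_neq (n : nat) (pi : 'S_n) (i j : 'I_n) :
  i < j -> (pi i : nat) <> pi j.
Proof. by move=> lt_ij /val_inj/perm_inj eq_ij; rewrite eq_ij ltnn in lt_ij. Qed.

(** A position beyond [i] belongs to the set exactly when it is counted by the
    code entry at [i], so this cardinal is [f i + i] in 1-based notation. *)
Lemma card_left_or_below (n : nat) (pi : 'S_n) (i : 'I_n) :
  #|left_or_below pi i| = inv_count pi i + i.+1.
Proof.
rewrite -[X in _ + X](card_ord_lt (ltn_ord i)) /inv_count -cardsUI.
rewrite (_ : _ :&: _ = set0) ?cards0 ?addn0.
  apply: eq_card => l; rewrite !inE ltnS orbC.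
  case: (leqP l i) => [_|lt_il]; rewrite ?orbT //= !orbF.
  by have := perm_ltn_neq (pi := pi) lt_il; lia.
by apply/setP=> l; rewrite !inE ltnS; case: leqP; rewrite ?andbF.
Qed.

Lemma descent_inv_count (n : nat) (pi : 'S_n) (j k : 'I_n) :
  k = j.+1 :> nat -> (inv_count pi k < inv_count pi j) = (pi k < pi j).
Proof.
move=> def_k; case: (ltnP (pi k) (pi j)) => [lt_kj | le_jk].
  apply/proper_card/properP; split.
    by apply/subsetP=> l; rewrite !inE; lia.
  by exists k; rewrite !inE; lia.
rewrite ltnNge subset_leq_card //; apply/subsetP=> l; rewrite !inE.
move=> /andP[lt_jl lt_lj].
have: l != k by apply: contraTneq lt_lj => ->; rewrite -leqNgt.
by rewrite -val_eqE /=; lia.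
Qed.

(** Left-to-right maxima seen from the code.  If [pi j] exceeds all earlier
    values, the sets of earlier positions are strictly contained in that of [j].
    Otherwise the position of the largest earlier value has a set that contains
    that of [j]. *)
Lemma record_left_or_below (n : nat) (pi : 'S_n) (j : 'I_n) :
  (forall i : 'I_n, i < j -> pi i < pi j) <->
  (forall i : 'I_n, i < j -> #|left_or_below pi i| < #|left_or_below pi j|).
Proof.
split=> [rec_j i lt_ij | card_j i lt_ij].
  apply/proper_card/properP; split; last first.
    by exists j; rewrite !inE ?leqnn // negb_or -!ltnNge lt_ij rec_j.
  apply/subsetP=> l; rewrite !inE => /orP[|] le_l; first by lia.
  by rewrite (leq_trans le_l (ltnW (rec_j _ lt_ij))) orbT.
rewrite ltnNge; apply/negP=> le_ji.
(* i0 carries the largest value placed before j; its set swallows that of j. *)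
case: (@arg_maxnP _ i (fun l : 'I_n => l < j) (fun l => pi l)) => //= i0 lt_i0 max_i0.
have := card_j _ lt_i0; rewrite ltnNge subset_leq_card //.
have le_j := leq_trans le_ji (max_i0 _ lt_ij).
apply/subsetP=> l; rewrite !inE; case: ltngtP => [lt_lj _|_ /= le_l|/val_inj -> _].
- by rewrite [pi l <= _]max_i0 ?orbT.
- by rewrite (leq_trans le_l le_j) orbT.
- by rewrite le_j orbT.
Qed.

(** Surjectivity of the Lehmer code.  The first entry of the code determines the
    first value of the permutation, and [lift_perm] inserts that value in front
    of a permutation which realizes the remaining entries. *)
Lemma inv_count_surj (n : nat) (f : nat -> nat) :
  (forall i, i < n -> f i < n - i) ->
  exists pi : 'S_n, forall i : 'I_n, inv_count pi i = f i.
Proof.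
elim: n f => [|n IHn] f lt_f; first by exists 1%g; case.
have [|s def_s] := IHn (fun i => f i.+1); first by move=> i /(lt_f i.+1); lia.
have lt_f0 := lt_f 0 isT; rewrite subn0 in lt_f0.
exists (lift_perm ord0 (Ordinal lt_f0) s) => i.
case: (unliftP ord0 i) => [k|] ->; rewrite /inv_count.
  rewrite lift_perm_lift -[RHS](def_s k) /inv_count -[RHS](card_imset _ (@lift_inj _ ord0)).
  apply: eq_card => l; rewrite inE.
  case: (unliftP ord0 l) => [l'|] ->.
    rewrite lift_perm_lift mem_imset; last exact: lift_inj.
    by rewrite inE !ltnNge /= !leq_bump2 negbK.
  rewrite ltn0; apply/esym/negbTE/imsetP=> -[x _] /eqP.
  by rewrite (negPf (neq_lift _ _)).
rewrite lift_perm_id -[RHS](card_ord_lt (ltnW lt_f0)).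
rewrite -[RHS](card_preimset _ (@perm_inj _ (lift_perm ord0 (Ordinal lt_f0) s))).
apply: eq_card => l; rewrite !inE /=.
case: (unliftP ord0 l) => [l'|] ->; first by [].
by rewrite lift_perm_id /= !ltnn.
Qed.

(** The image of the avoiding permutations, described by inequalities on codes
    indexed from 1: a code bound, and the condition that every descent top is a
    left-to-right maximum. *)
Definition good_code (n : nat) (f : nat -> nat) : Prop :=
  (forall i, 0 < i <= n -> f i + i <= n) /\
  (forall i j, 0 < i < j -> j < n -> f j.+1 < f j -> f i + i < f j + j).

Lemma codes_3_21P (n : nat) (p : n.-tuple nat) :
  codes_3_21 p <-> good_code n (ent p).
Proof.
have avoidsP (pi : 'S_n) : avoids_3_21 pi <-> good_code n (ent (lehmer pi)).
  have entE := ent_lehmer pi.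
  split=> [av | [_ good] [i [j [k [lt_ij def_k lt_ji lt_kj]]]]].
    split=> [[|i]//= lt_in | [|i] [|j] // /= lt_ij lt_jn].
      rewrite (entE (Ordinal lt_in)) -card_left_or_below -[leqRHS]card_ord.
      exact: max_card.
    have lt_j : j < n by lia.
    have lt_i : i < n by lia.
    rewrite (entE (Ordinal lt_jn)) (entE (Ordinal lt_j)) (entE (Ordinal lt_i)).
    rewrite descent_inv_count // => desc_j.
    rewrite -[X in X < _]card_left_or_below -[X in _ < X]card_left_or_below.
    apply: (record_left_or_below pi (Ordinal lt_j)).1 => // i' lt_i'.
    rewrite ltn_neqAle leqNgt andbC; apply/andP; split.
      apply/negP=> gt_i'; case: av.
      by exists i', (Ordinal lt_j), (Ordinal lt_jn).
    exact/eqP/perm_ltn_neq.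
  have rec_j: forall i' : 'I_n, i' < j -> pi i' < pi j.
    apply/record_left_or_below=> i' lt_i'; rewrite !card_left_or_below -!entE.
    apply: good; [by [] | by rewrite -def_k |].
    by have := descent_inv_count pi def_k; rewrite -!entE def_k lt_kj.
  by have := rec_j _ lt_ij; rewrite ltnNge ltnW.
split=> [[pi av ->] | good]; first exact/avoidsP.
have [|pi def_pi] := @inv_count_surj n (nth 0 p).
  by move=> i lt_in; have := good.1 i.+1; rewrite /ent /=; lia.
have def_p : p = lehmer pi.
  apply: eq_from_tnth => i; rewrite (tnth_nth 0) tnth_mktuple -def_pi //.
by exists pi => //; apply/avoidsP; rewrite -def_p.
Qed.

(** * Maximality for functions on positions *)

Definition code_of (n : nat) (f : nat -> nat) : n.-tuple nat :=
  [tuple f i.+1 | i < n].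

Lemma ent_code_of (n : nat) (f : nat -> nat) (i : nat) :
  0 < i <= n -> ent (code_of n f) i = f i.
Proof.
case: i => //= i lt_in.
by rewrite /ent -(tnth_nth 0 (code_of n f) (Ordinal lt_in)) tnth_mktuple.
Qed.

Lemma eq_good_code (n : nat) (f g : nat -> nat) :
  (forall i, 0 < i <= n -> f i = g i) -> good_code n f -> good_code n g.
Proof.
move=> eq_fg [bnd desc]; split=> [i le_in | i j lt_ij lt_jn].
  by rewrite -eq_fg ?bnd.
by rewrite -!eq_fg; [apply: desc | lia..].
Qed.

Lemma Max_codesP (n : nat) (p : n.-tuple nat) :
  Max_codes_3_21 p <->
  good_code n (ent p) /\
  (forall f, good_code n f -> (forall i, 0 < i <= n -> ent p i <= f i) ->
     forall i, 0 < i <= n -> f i = ent p i).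
Proof.
split=> [[/codes_3_21P good_p max_p] | [good_p max_p]].
  split=> // f good_f le_pf i le_in.
  have entf j : 0 < j <= n -> ent (code_of n f) j = f j by apply: ent_code_of.
  rewrite -entf // (max_p (code_of n f)) //.
    by apply/codes_3_21P; apply: eq_good_code good_f => *; rewrite entf.
  by move=> j le_jn; rewrite entf // le_pf.
split=> [|q /codes_3_21P good_q le_pq]; first exact/codes_3_21P.
apply: eq_from_tnth => i; rewrite !(tnth_nth 0).
exact: (max_p _ good_q le_pq i.+1 (ltn_ord i)).
Qed.

(** * The filling determined by a set of descents *)

(** Intervals are numbered from 0: interval [k] ends at [nth 0 d k] for
    [k < size d], and interval [size d] is the one after all of [d]. *)
Definition block (d : seq nat) (i : nat) : nat := find (leq i) d.

(** The function that (b) and (c) prescribe: the value at the right end of an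
    interval is forced by (b), and it is 0 on the last interval because a code
    ends with 0. *)
Definition fill (n : nat) (d : seq nat) (i : nat) : nat :=
  let k := block d i in
  if k < size d then n - (size d - k.+1) - nth 0 d k else 0.

Lemma block_le (d : seq nat) (i : nat) : block d i <= size d.
Proof. exact: find_size. Qed.

Lemma le_nth_block (d : seq nat) (i : nat) :
  block d i < size d -> i <= nth 0 d (block d i).
Proof. by rewrite -has_find; apply: nth_find. Qed.

Lemma nth_lt_block (d : seq nat) (i k : nat) :
  k < block d i -> nth 0 d k < i.
Proof. by move/(before_find 0); rewrite leqNgt => /negbFE. Qed.

Lemma blockP (d : seq nat) (i k : nat) : sorted ltn d -> k <= size d ->
  (0 < k -> nth 0 d k.-1 < i) -> (k < size d -> i <= nth 0 d k) ->
  block d i = k.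
Proof.
move=> d_incr le_k lt_i le_i; have mono := sorted_ltn_nth ltn_trans 0 d_incr.
case: (ltngtP (block d i) k) => // [lt_b | gt_b].
  have lt_bs : block d i < size d by lia.
  have := le_nth_block lt_bs; have := lt_i ltac:(lia).
  case: (ltngtP (block d i) k.-1) => [lt_b' | | ->]; [|lia|lia].
  have := mono (block d i) k.-1; rewrite !inE => /(_ lt_bs ltac:(lia) lt_b') /=.
  by lia.
have le_b := block_le d i; have := nth_lt_block gt_b.
by have := le_i ltac:(lia); lia.
Qed.

Lemma block_nth (d : seq nat) (k : nat) :
  sorted ltn d -> k < size d -> block d (nth 0 d k) = k.
Proof.
move=> d_incr lt_k; apply: blockP => // [|k_gt0]; first exact: ltnW.
by apply: (sorted_ltn_nth ltn_trans 0 d_incr); rewrite ?inE; lia.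
Qed.

(** Only the elements of [d] separate intervals, which is why [fill] can descend
    only there. *)
Lemma block_succ (d : seq nat) (i : nat) :
  i \notin d -> block d i.+1 = block d i.
Proof.
move=> d'i; apply: eq_in_find => x d_x.
by rewrite ltn_neqAle; case: eqP d'i => // ->; rewrite d_x.
Qed.

Lemma block_mono (d : seq nat) (i j : nat) :
  i <= j -> block d i <= block d j.
Proof. by move=> le_ij; apply: sub_find => x; apply: leq_trans. Qed.

Section Filling.

Variables (n : nat) (d : seq nat).
Hypotheses (d_incr : sorted ltn d) (d_range : forall x : nat, x \in d -> 0 < x < n).

Let lt_nth (k l : nat) : k < l < size d -> nth 0 d k < nth 0 d l.
Proof.
move=> lt_kl; apply: (sorted_ltn_nth ltn_trans 0 d_incr); rewrite ?inE; lia.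
Qed.

Let range_nth (k : nat) : k < size d -> 0 < nth 0 d k < n.
Proof. by move=> lt_k; apply/d_range/mem_nth. Qed.

Let mem_nthP (j : nat) : j \in d -> exists2 k, k < size d & nth 0 d k = j.
Proof. exact/nthP. Qed.

(** There are [size d - k.+1] elements of [d] between [nth 0 d k] and [n], so the
    truncated subtractions in [fill] never lose anything. *)
Lemma nth_lt_level (k : nat) : k < size d -> nth 0 d k < n - (size d - k.+1).
Proof.
move=> lt_k; have [r def_r] : exists r, size d = k.+1 + r.
  by exists (size d - k.+1); lia.
elim: r k lt_k def_r => [|r IHr] k lt_k def_r.
  by have := range_nth lt_k; lia.
by have := IHr k.+1; have := @lt_nth k k.+1; lia.
Qed.

Lemma fill_level (k : nat) : k < size d ->
  fill n d (nth 0 d k) + nth 0 d k = n - (size d - k.+1).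
Proof.
by move=> lt_k; have := nth_lt_level lt_k; rewrite /fill block_nth ?lt_k //; lia.
Qed.

(** Inside an interval, [fill n d i + i] grows with [i] up to the level reached
    at the right end. *)
Lemma fill_le_level (i : nat) : block d i < size d ->
  fill n d i + i <= n - (size d - (block d i).+1).
Proof.
move=> lt_b; have := nth_lt_level lt_b; have := le_nth_block lt_b.
by rewrite /fill lt_b; lia.
Qed.

Lemma fill_descent (j : nat) : fill n d j.+1 < fill n d j -> j \in d.
Proof.
by apply: contraLR => d'j; rewrite /fill block_succ // ltnn.
Qed.

(** A descent [j] of [fill] is the right end of its interval, where
    [fill n d j + j] is the level of that interval.  Earlier positions stay
    below it, since levels increase from one interval to the next. *)
Lemma good_fill : good_code n (fill n d).
Proof.
split=> [i le_in | i j lt_ij lt_jn /fill_descent].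
  case: (ltnP (block d i) (size d)) => [lt_b | ge_b].
    by have := fill_le_level lt_b; lia.
  by rewrite /fill ltnNge ge_b /=; lia.
case/mem_nthP=> k lt_k def_j; rewrite -def_j fill_level //.
have le_b : block d i <= k.
  by rewrite -(block_nth d_incr lt_k); apply: block_mono; lia.
have lt_b := leq_ltn_trans le_b lt_k.
have := nth_lt_level lt_k; have := fill_le_level lt_b.
move: le_b; rewrite leq_eqVlt => /orP[/eqP eq_b | lt_bk]; last by lia.
by rewrite /fill eq_b lt_k; lia.
Qed.

(** By induction from the right end.  At a descent, the next descent has a
    strictly larger [f j + j], while the levels of [fill] differ by exactly one (at
    the last descent the code bound takes over); elsewhere [f i <= f i.+1] and the two
    positions share an interval. *)
Lemma good_le_fill (f : nat -> nat) : good_code n f ->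
  (forall j, 0 < j < n -> (f j.+1 < f j) = (j \in d)) ->
  forall i, 0 < i <= n -> f i <= fill n d i.
Proof.
move=> [bnd good] f_desc i le_in.
have [r def_r] : exists r, n = i + r by exists (n - i); lia.
elim/ltn_ind: r i le_in def_r => r IHr i le_in def_r.
have {}IHr i' : i < i' <= n -> f i' <= fill n d i'.
  by move=> lt_i; apply: (IHr (n - i')); lia.
have [d_i | d'i] := boolP (i \in d).
  case/mem_nthP: (d_i) => k lt_k def_i; have := fill_level lt_k; rewrite def_i.
  have := bnd i le_in; case: (ltngtP k.+1 (size d)) lt_k => // [lt_k1|<-] _; last by lia.
  have lt_ik1 := @lt_nth k k.+1 ltac:(lia).
  have d_k1 : nth 0 d k.+1 \in d := mem_nth 0 lt_k1.
  have range_k1 := range_nth lt_k1.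
  have lt_f : f i + i < f (nth 0 d k.+1) + nth 0 d k.+1.
    by apply: good; rewrite ?f_desc //; lia.
  have := fill_level lt_k1; have := IHr (nth 0 d k.+1); lia.
case: (ltnP i n) => [lt_in | ge_in]; last by have := bnd i le_in; lia.
have := f_desc i; rewrite (negPf d'i) => /(_ ltac:(lia)) /negbT.
have := IHr i.+1; rewrite /fill block_succ //; lia.
Qed.

(** By induction from the right end.  An excess of [f] over [fill] at [i] makes
    [i] a descent of [f], because [f] agrees with [fill] at [i.+1].  If [i] is the
    right end of an interval, then [f i + i] exceeds the level there, so it is at
    least the level of the next interval, against the condition at the next
    descent.  Otherwise [f i + i] has to lie strictly between the levels of the
    previous interval and of its own, which are consecutive integers.  After the
    last level, which is [n], the code bound gives the contradiction. *)
Lemma fill_maximal (f : nat -> nat) :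
  0 < size d -> nth 0 d 0 <= 2 ->
  good_code n f ->
  (forall j, j \in d -> fill n d j.+1 < fill n d j) ->
  (forall i, 0 < i <= n -> fill n d i <= f i) ->
  forall i, 0 < i <= n -> f i = fill n d i.
Proof.
move=> d_gt0 d0_le2 [bnd good] fill_desc le_f i le_in.
have [r def_r] : exists r, n = i + r by exists (n - i); lia.
elim/ltn_ind: r i le_in def_r => r IHr i le_in def_r.
have {}IHr i' : i < i' <= n -> f i' = fill n d i'.
  by move=> lt_i; apply: (IHr (n - i')); lia.
have le_fi := le_f i le_in; have bnd_i := bnd i le_in.
apply/eqP; rewrite eqn_leq le_fi andbT leqNgt; apply/negP=> lt_fi.
have lt_in : i < n by lia.
have eq_i1 := IHr i.+1 ltac:(lia).
have desc_i : f i.+1 < f i.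
  rewrite eq_i1; have [/fill_desc|d'i] := boolP (i \in d); first by lia.
  by rewrite /fill block_succ.
(* f dominates fill at the ends of the earlier intervals, and i is a descent. *)
have before k : k < block d i -> n - (size d - k.+1) < f i + i.
  move=> lt_k; have lt_ks := leq_trans lt_k (block_le d i).
  have := nth_lt_block lt_k; have := range_nth lt_ks => range_k lt_ki.
  have := good (nth 0 d k) i ltac:(lia) lt_in desc_i.
  have := le_f (nth 0 d k) ltac:(lia); have := fill_level lt_ks; lia.
case: (ltnP (block d i) (size d)) => [lt_b | ge_b]; last first.
  by have := before (size d).-1; lia.
have d_b : nth 0 d (block d i) \in d := mem_nth 0 lt_b.
have lvl_b := fill_level lt_b; have range_b := range_nth lt_b.
have := le_nth_block lt_b; rewrite leq_eqVlt => /orP[/eqP def_i | lt_i].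
  rewrite -def_i in lvl_b.
  case: (ltngtP (block d i).+1 (size d)) lt_b => // [lt_b1|eq_b] lt_b; last by lia.
  have d_b1 : nth 0 d (block d i).+1 \in d := mem_nth 0 lt_b1.
  have range_b1 := range_nth lt_b1.
  have lt_ib1 := @lt_nth (block d i) (block d i).+1 ltac:(lia).
  set j := nth 0 d _.+1 in d_b1 range_b1 lt_ib1.
  have desc_j : f j.+1 < f j by rewrite !IHr ?(fill_desc j d_b1) //; lia.
  have := good i j ltac:(lia) ltac:(lia) desc_j.
  by rewrite (IHr j) ?fill_level; lia.
set j := nth 0 d (block d i) in d_b range_b lt_i lvl_b.
have fill_ij : fill n d i = fill n d j by rewrite /fill block_nth.
have desc_j : f j.+1 < f j by rewrite !IHr ?(fill_desc j d_b) //; lia.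
have := good i j ltac:(lia) ltac:(lia) desc_j; rewrite (IHr j); last by lia.
(* Without an interval before, the bound on the first descent leaves only i = 1
   and j = 2, and the condition at j gives f 1 + 1 < fill 2 + 2 with
   fill 1 = fill 2. *)
have [b_eq0 | b_gt0] := posnP (block d i); last by have := before (block d i).-1; lia.
have : j <= 2 by rewrite /j b_eq0.
by lia.
Qed.

End Filling.

(** * Raising the first entry *)

(** The only new comparison is between position 1 and a descent [j > 2].  Since
    [f 1 <= f 2], the raised sum [f 1 + 2] is at most [f 2 + 2], which the
    condition on [j] bounds already.  A descent at 2 could break this. *)
Lemma good_raise_first (n : nat) (f : nat -> nat) : 2 <= n ->
  good_code n f -> f 1 <= f 2 -> (2 < n -> f 2 <= f 3) ->
  good_code n (fun i => if i == 1 then (f 1).+1 else f i).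
Proof.
move=> n_ge2 [bnd good] le_f12 le_f23; split=> [i le_in | i j lt_ij lt_jn].
  by case: eqP => [->|_]; [have := bnd 2 | have := bnd i]; lia.
have [def_j | j_neq1] := eqVneq j 1; first by rewrite def_j in lt_ij; lia.
rewrite eqSS; case: eqP => [|_]; first by lia.
case: eqP => [def_i|_] desc_j; last exact: good.
have [def_j | j_neq2] := eqVneq j 2; first by move: desc_j le_f23; rewrite def_j; lia.
by have := good 2 j; rewrite def_i; lia.
Qed.

(** * The characterization *)

(** The intervals in (c) are the fibres of [block], and on each of them (b) gives
    the value at the right end, so (b) and (c) together say that [p] is the
    filling.  On the last interval the value is that of the final entry of a
    code, which is 0. *)
Lemma fillP (n : nat) (p : n.-tuple nat) (m : nat) (d : m.-tuple nat) :
  is_lehmer_code p -> sorted ltn d -> (forall x : nat, x \in d -> 0 < x < n) ->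
  (forall i, 0 < i <= n -> ent p i = fill n d i) <->
  (forall j, 1 <= j <= m -> ent p (ent d j) + ent d j = n - (m - j)) /\
  (forall j, 0 <= j <= m ->
     constant_on p (breakpoint n d j).+1 (breakpoint n d j.+1)).
Proof.
move=> hp d_incr d_range; have size_d : size d = m by rewrite size_tuple.
have brk k : k < m -> breakpoint n d k.+1 = nth 0 d k.
  by move=> lt_km; rewrite /breakpoint /= nth_rcons size_d lt_km.
have brk_last : breakpoint n d m.+1 = n.
  by rewrite /breakpoint /= nth_rcons size_d ltnn eqxx.
have in_block k i : k <= m -> 0 < i <= n ->
  breakpoint n d k < i <= breakpoint n d k.+1 <-> block d i = k.
  move=> le_km le_in; split=> [/andP[gt_i le_i] | <-].
    rewrite -size_d in le_km; apply: blockP => // [k_gt0 | lt_km].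
      by rewrite -brk ?prednK //; lia.
    by rewrite -brk -?size_d.
  apply/andP; split.
    case def_b: (block d i) => [|b]; first by rewrite /breakpoint /=; lia.
    by rewrite brk ?nth_lt_block ?def_b //; have := block_le d i; lia.
  have := block_le d i; rewrite size_d leq_eqVlt => /orP[/eqP -> | lt_b].
    by rewrite brk_last; lia.
  by rewrite brk // le_nth_block ?size_d.
have brk_le k : k <= m -> breakpoint n d k.+1 <= n.
  rewrite leq_eqVlt => /orP[/eqP -> | lt_km]; first by rewrite brk_last.
  have d_k : nth 0 d k \in d by rewrite mem_nth ?size_d.
  by have := d_range _ d_k; rewrite brk //; lia.
split=> [def_p | [p_b p_c] i le_in].
  split=> [[|k] //= lt_km | j le_jm i i' in_i in_i'].
    have d_k : nth 0 d k \in d by rewrite mem_nth ?size_d.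
    rewrite /ent /= -/(ent p _) def_p; last by have := d_range _ d_k; lia.
    by rewrite fill_level ?size_d.
  have le_n := brk_le j le_jm.
  have le_in : 0 < i <= n by lia.
  have le_i'n : 0 < i' <= n by lia.
  rewrite !def_p // /fill.
  by rewrite ((in_block j i le_jm le_in).1 in_i) ((in_block j i' le_jm le_i'n).1 in_i').
have := block_le d i; rewrite size_d => le_b.
have in_i := (in_block _ i le_b le_in).2 erefl.
have -> : ent p i = ent p (breakpoint n d (block d i).+1).
  by apply: p_c (le_b) _ _ _ _ => //; move: in_i; lia.
rewrite /fill size_d; case: ltnP => [lt_b | ge_b].
  have := p_b (block d i).+1 lt_b.
  by rewrite brk // -[ent d _]/(nth 0 d (block d i)); lia.
have -> : block d i = m by lia.
by rewrite brk_last; have := hp n; lia.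
Qed.

Theorem lemma4p3 (n : nat) (hn : 2 <= n) (p : n.-tuple nat)
    (hp : is_lehmer_code p)
    (m : nat) (d : m.-tuple nat)
    (d_incr : sorted ltn d)
    (d_descents : forall j : nat, j \in d = descent p j) :
  Max_codes_3_21 p <->
  [/\ (* (a) *)
      1 <= m /\ (ent d 1 = 1 \/ ent d 1 = 2),
      (* (b) *)
      forall j : nat, 1 <= j <= m ->
        ent p (ent d j) + ent d j = n - (m - j)
    & (* (c) *)
      forall j : nat, 0 <= j <= m ->
        constant_on p (breakpoint n d j).+1 (breakpoint n d j.+1)].
Proof.
have size_d : size d = m by rewrite size_tuple.
have d_desc j : 0 < j < n -> (ent p j.+1 < ent p j) = (j \in d).
  by rewrite d_descents /descent; lia.
have d_range j : j \in d -> 0 < j < n by rewrite d_descents /descent; lia.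
have fillP := fillP hp d_incr d_range.
rewrite Max_codesP; split=> [[good_p max_p] | [[m_gt0 d1_le2] p_b p_c]].
  have le_p := good_le_fill d_incr d_range good_p d_desc.
  have fill_p i le_in := esym (max_p _ (good_fill d_incr d_range) le_p i le_in).
  have [p_b p_c] := fillP.1 fill_p; split=> //.
  have [/andP[m_gt0 d1_le2] | d1_gt2] := boolP ((0 < m) && (ent d 1 <= 2)).
    have d_1 : ent d 1 \in d by rewrite mem_nth ?size_d.
    by split=> //; have := d_range _ d_1; lia.
  have gt2 x : x \in d -> 2 < x.
    case/(nthP 0)=> k; rewrite size_d => lt_km <-.
    have lt_0m : 0 < m by lia.
    rewrite lt_0m -ltnNge /= in d1_gt2; apply: leq_trans d1_gt2 _.
    rewrite /ent /=; case: k lt_km => // k lt_km; apply: ltnW.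
    by apply: (sorted_ltn_nth ltn_trans 0 d_incr); rewrite ?inE ?size_d.
  have no_desc j : 0 < j < n -> j <= 2 -> ent p j <= ent p j.+1.
    move=> lt_jn le_j2; rewrite leqNgt d_desc //.
    by apply/negP=> /gt2; lia.
  have good_r := good_raise_first hn good_p (no_desc 1 hn isT)
    (fun lt_2n => no_desc 2 lt_2n isT).
  have := max_p _ good_r _ 1 (ltnW hn); rewrite /= => le_r.
  suff: (ent p 1).+1 = ent p 1 by lia.
  by apply: le_r => i le_in; case: eqP => [->|].
have fill_p := fillP.2 (conj p_b p_c).
split=> [|f good_f le_pf i le_in].
  by apply: eq_good_code (good_fill d_incr d_range) => i /fill_p.
rewrite fill_p //; apply: (fill_maximal d_incr d_range) => //.
- by rewrite size_d.
- by rewrite -[nth _ _ _]/(ent d 1); lia.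
- move=> j d_j; have lt_jn := d_range j d_j.
  by rewrite -!fill_p ?d_desc //; lia.
- by move=> j le_jn; rewrite -fill_p ?le_pf.
Qed.
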